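(* Let $\mathcal{H}\subset\mathsf{E}$ be a crooked halfspace. Then every $p\in\mathcal{H}$ lies on a particle contained in $\mathcal{H}$.
   Context: $\mathsf{V}$ is an oriented real $3$-dimensional vector space with an inner product $\mathbf{u}\cdot\mathbf{v}$ of signature $(2,1)$ and a chosen time-orientation: one of the two components of the set of timelike vectors ($\mathbf{v}\cdot\mathbf{v}<0$) is selected and called $\mathsf{Future}$. A nonzero non-spacelike vector is future-pointing if it lies in the closure of $\mathsf{Future}$. $\mathsf{E}$ (Minkowski space) is an affine space with group of translations $\mathsf{V}$. A vector $\mathbf{s}$ is unit-spacelike if $\mathbf{s}\cdot\mathbf{s}=1$. For such $\mathbf{s}$, $\mathbf{s}^-,\mathbf{s}^+\in\mathbf{s}^\perp$ denote future-pointing null vectors with $\mathbf{s}^-\cdot\mathbf{s}^+=-1$ such that $(\mathbf{s},\mathbf{s}^-,\mathbf{s}^+)$ is a positively oriented basis of $\mathsf{V}$. For $o\in\mathsf{E}$ and $\mathbf{s}$ unit-spacelike, the (open) crooked halfspace with vertex $o$ and director $\mathbf{s}$ is $$\mathcal{H}(o,\mathbf{s})=\{q: (q-o)\cdot\mathbf{s}^+<0,\ (q-o)\cdot\mathbf{s}>0\}\cup\{q:(q-o)\cdot\mathbf{s}^+<0,\ (q-o)\cdot\mathbf{s}^->0,\ (q-o)\cdot\mathbf{s}=0\}\cup\{q:(q-o)\cdot\mathbf{s}^->0,\ (q-o)\cdot\mathbf{s}<0\}.$$ A crooked halfspace is a set of this form. A particle is an affine line $q+\mathbb{R}\mathbf{v}$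 with $\mathbf{v}$ timelike. *)

(* Defs.v *)
From mathcomp Require Import all_boot all_order all_algebra.
From mathcomp Require Import all_classical reals topology normedtype.

Set Implicit Arguments.
Unset Strict Implicit.
Unset Printing Implicit Defensive.

Import Order.TTheory GRing.Theory Num.Theory.
Import numFieldNormedType.Exports.

Local Open Scope classical_set_scope.
Local Open Scope ring_scope.

(* Nonempty affine space with group of translations V; [adiff q p] is the
   vector q - p from p to q. *)
Record affineSpace (V : zmodType) := AffineSpace {
  point :> Type;
  translate : point -> V -> point;
  adiff : point -> point -> V;
  _ : inhabited point;
  _ : forall p, translate p 0 = p;
  _ : forall p u v, translate (translate p u) v = translate p (u + v);
  _ : forall p q v, translate p v = q <-> v = adiff q p
}.

Section MinkowskiVectors.
Context (R : realType) (V : vectType R).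

(* The standard topology of a finite-dimensional real vector space: the one
   making the coordinate isomorphism V -> 'rV_n in a basis a homeomorphism. *)
Definition vtop : topologicalType :=
  initial_topology
    (fun v : V => (\row_i coord (vbasis fullv) i v) : 'rV[R]_(\dim {:V})).

(* [dot] is diagonal, with p entries 1 followed by q entries -1, in some
   basis of V. *)
Definition has_signature (dot : {symmetric V}) (p q : nat) : Prop :=
  exists2 b : (p + q).-tuple V, basis_of fullv b &
    forall i j : 'I_(p + q),
      dot b`_i b`_j = if i == j then (if (i < p)%N then 1 else -1) else 0.

(* An orientation of a 3-dimensional V is the set of its positively oriented
   ordered bases, a class of bases under positive-determinant base change. *)
Definition orientation (O : set (3.-tuple V)) : Prop :=
  exists2 b : 3.-tuple V, basis_of fullv b &
    O = [set c : 3.-tuple V | basis_of fullv c /\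
           0 < \det (\matrix_(i < 3, j < 3) (coord b j c`_i : R))].

Context (dot : {symmetric V}).

Definition timelike (v : V) : Prop := dot v v < 0.
Definition spacelike (v : V) : Prop := 0 < dot v v.
Definition null_vector (v : V) : Prop := v != 0 /\ dot v v = 0.
Definition unit_spacelike (v : V) : Prop := dot v v = 1.

Definition time_orientation (Future : set V) : Prop :=
  exists2 v : V, timelike v &
    Future = @connected_component vtop (timelike : set V) v.

Definition future_pointing (Future : set V) (v : V) : Prop :=
  [/\ v != 0, ~ spacelike v & @closure vtop Future v].

(* [sm] and [sp] are admissible choices of the vectors s^- and s^+; they are
   determined by s only up to (sm, sp) |-> (a *: sm, a^-1 *: sp), a > 0. *)
Definition null_frame (O : set (3.-tuple V)) (Future : set V)
    (s sm sp : V) : Prop :=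
  [/\ dot sm s = 0 /\ dot sp s = 0,
      null_vector sm /\ null_vector sp,
      future_pointing Future sm /\ future_pointing Future sp,
      dot sm sp = -1 &
      O [tuple s; sm; sp]].

Context (E : affineSpace V).

Definition crooked_set (o : E) (s sm sp : V) : set E :=
  [set q | dot (adiff q o) sp < 0 /\ dot (adiff q o) s > 0] `|`
  [set q | [/\ dot (adiff q o) sp < 0, dot (adiff q o) sm > 0 &
              dot (adiff q o) s = 0]] `|`
  [set q | dot (adiff q o) sm > 0 /\ dot (adiff q o) s < 0].

Definition crooked_halfspace (O : set (3.-tuple V)) (Future : set V)
    (H : set E) : Prop :=
  exists (o : E) (s sm sp : V),
    [/\ unit_spacelike s, null_frame O Future s sm sp &
        H = crooked_set o s sm sp].

Definition particle (L : set E) : Prop :=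
  exists (q : E) (v : V),
    timelike v /\ L = [set translate q (t *: v) | t in [set: R]].

End MinkowskiVectors.

(* Main.v *)
(** Let [s], [sm], [sp] be the director and its null frame, and for [w] in [V]
    put [a = w.s], [b = w.sp], [c = w.sm].  For [x, y > 0] with [2xy > 1] the
    vector [v = s + x sm + y sp] is timelike, and both [b + x a] and [c + y a]
    are constant along lines of direction [v].  The conditions [b + x a < 0]
    and [c + y a > 0] force the crooked halfspace inequalities whatever the
    sign of [a]; conversely, those inequalities at one point leave room to
    choose [x] and [y] so that both conditions hold there, hence along the
    whole line through it. *)
Require Import Defs.
From mathcomp Require Import all_boot all_order all_algebra.
From mathcomp Require Import all_classical reals topology normedtype.
From mathcomp Require Import ring lra.

Import Order.TTheory GRing.Theory Num.Theory.

Local Open Scope classical_set_scope.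
Local Open Scope ring_scope.

Lemma adiff_translate (V : zmodType) (E : affineSpace V) (p o : E) (u : V) :
  adiff (translate p u) o = adiff p o + u.
Proof.
case: E p o => T tr ad inhT tr0 trD trP p o /=.
by apply/esym/trP; rewrite -trD; congr tr; apply/trP.
Qed.

Lemma translate0 (V : zmodType) (E : affineSpace V) (p : E) :
  translate p 0 = p.
Proof. by case: E p. Qed.

Section CrookedCoordinates.
Context {R : realFieldType}.
Implicit Types a b c x y : R.

Definition crooked_coords a b c : Prop :=
  [\/ b < 0 /\ 0 < a, [/\ b < 0, 0 < c & a = 0] | 0 < c /\ a < 0].

Lemma crooked_coords_slopes a b c : crooked_coords a b c ->
  exists x y, [/\ 0 < x, 0 < y, 1 < 2 * x * y, b + x * a < 0 & 0 < c + y * a].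
Proof.
(* The case [a > 0], stated for general [e], [d], [f] so that it also serves [a < 0]. *)
have slopes (e d f : R) : 0 < e -> d < 0 ->
    exists x y, [/\ 0 < x, 0 < y, 1 < 2 * x * y, d + x * e < 0 & 0 < f + y * e].
  (* Half of the upper bound [- d / e], so that [d + x * e = d / 2]. *)
  move=> e0 d0; pose x := - d / (2 * e).
  have x0 : 0 < x by rewrite divr_gt0 //; lra.
  (* The term [x^-1] makes [x * y >= 1]; the other absorbs a negative [f]. *)
  exists x, (x^-1 + `|f| / e).
  have xV0 : 0 < x^-1 by rewrite invr_gt0.
  have fe0 : 0 <= `|f| / e by rewrite divr_ge0 // ltW.
  have xVe : 0 < x^-1 * e by rewrite mulr_gt0.
  have xfe : 0 <= x * (`|f| / e) by rewrite mulr_ge0 // ltW.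
  have xxV : x * x^-1 = 1 by rewrite divff // gt_eqF.
  have xe : x * e = - d / 2 by rewrite /x; field; rewrite gt_eqF.
  split; [by []|lra|by rewrite -mulrA mulrDr xxV; lra|by rewrite xe; lra|].
  rewrite mulrDl divfK ?gt_eqF //.
  by have := ler_norm (- f); rewrite normrN; lra.
case=> [[b0 a0]|[b0 c0 ->]|[c0 a0]].
- exact: slopes.
- by exists 1, 1; split; lra.
(* The symmetry [(a, b, c) -> (- a, - c, - b)] exchanges [x] and [y]. *)
- have [||y [x [y0 x0 xy ya xa]]] := slopes (- a) (- c) (- b); [lra|lra|].
  by exists x, y; split=> //; [rewrite mulrAC|lra|lra].
Qed.

(** The sign of [a] selects the clause: [a < 0] gives [c > - y * a > 0], and [a > 0] gives
    [b < - x * a < 0]. *)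
Lemma slopes_crooked_coords x y a b c : 0 < x -> 0 < y ->
  b + x * a < 0 -> 0 < c + y * a -> crooked_coords a b c.
Proof.
move=> x0 y0 ba ca; case: (ltgtP a 0) => [a0|a0|a0].
- have ya : y * a < 0 by rewrite pmulr_rlt0.
  by apply: Or33; split=> //; lra.
- have xa : 0 < x * a by rewrite mulr_gt0.
  by apply: Or31; split=> //; lra.
- by move: ba ca; rewrite a0 !mulr0 !addr0 => b0 c0; apply: Or32.
Qed.

End CrookedCoordinates.

Lemma crooked_setE (R : realType) (V : vectType R) (dot : {symmetric V})
    (E : affineSpace V) (o q : E) (s sm sp : V) :
  crooked_set dot o s sm sp q <->
  crooked_coords (dot (adiff q o) s) (dot (adiff q o) sp) (dot (adiff q o) sm).
Proof.
split; first by case=> [[]|]; [apply: Or31|apply: Or32|apply: Or33].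
by case=> ?; [left; left|left; right|right].
Qed.

Theorem theorem5p5 (R : realType) (V : vectType R)
    (dimV : \dim {:V} = 3%N)
    (Orient : set (3.-tuple V)) (orientationV : orientation Orient)
    (dot : {symmetric V}) (sig : has_signature dot 2 1)
    (Future : set V) (timeFuture : time_orientation dot Future)
    (E : affineSpace V)
    (H : set E) (crookedH : crooked_halfspace dot Orient Future H) :
  forall p : E, H p ->
    exists L : set E, [/\ particle dot L, L p & L `<=` H].
Proof.
case: crookedH => o [s [sm [sp [ss [[sms sps] [[_ mm] [_ pp]] _ smp _] ->]]]].
move=> p /crooked_setE/crooked_coords_slopes[x [y [x0 y0 xy pb pc]]].
have dotC u w : dot u w = dot w u.
  by rewrite [LHS]hermC /= expr0 mul1r.
have spm : dot sp sm = -1 by rewrite dotC.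
pose v := s + x *: sm + y *: sp.
have dotv w : dot v w = dot s w + x * dot sm w + y * dot sp w.
  by rewrite /v !linearDl !linearZl_LR.
have vs : dot v s = 1 by rewrite dotv ss sms sps; ring.
have vm : dot v sm = - y by rewrite dotv (dotC s) sms mm spm; ring.
have vp : dot v sp = - x by rewrite dotv (dotC s) sps smp pp; ring.
have vv : dot v v = 1 - 2 * x * y.
  by rewrite dotv (dotC s) (dotC sm) (dotC sp) vs vm vp; ring.
exists [set translate p (t *: v) | t in [set: R]]; split.
- by exists p, v; split=> //; rewrite /timelike vv; lra.
- by exists 0 => //; rewrite scale0r translate0.
(* Translation by [t *: v] adds [t], [- t * x], [- t * y] to [a], [b], [c], and these cancel in
   [b + x * a] and [c + y * a]. *)
- move=> _ [t _ <-]; apply/crooked_setE.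
  rewrite adiff_translate !linearDl !linearZl_LR /= vs vm vp.
  by apply: (slopes_crooked_coords x y) => //; lra.
Qed.
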